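(* Let $\mu$ and $\nu$ be valuated matroids on a common ground set $[n]$ and let $S\subseteq[n]$. Then $\mu_S\twoheadleftarrow\nu$ if and only if $\mathrm{pr}^{\operatorname{trop}}_S(\overline{\operatorname{trop}}(\mu))\subseteq\overline{\operatorname{trop}}(\nu)$.
   Context: $\mathbb T=\mathbb R\cup\{\infty\}$ (min-plus), $\mathbb P(\mathbb T^N)=(\mathbb T^N\setminus\{(\infty,\dots,\infty)\})/\mathbb R\mathbf 1$. A valuated matroid of rank $r$ on $[n]$ is $\nu:\binom{[n]}r\to\mathbb T$, not identically $\infty$, such that for all $I,J\in\binom{[n]}r$ and $i\in I\setminus J$ there is $j\in J\setminus I$ with $\nu(I)+\nu(J)\ge\nu(I\setminus i\cup j)+\nu(J\setminus j\cup i)$; taken up to additive constants. Quotient: for $\mu,\nu$ of ranks $a\le b$, $\mu\twoheadleftarrow\nu$ means for all $I\in\binom{[n]}a$, $J\in\binom{[n]}b$, $i\in I\setminus J$ there is $j\in J\setminus I$ with $\mu(I)+\nu(J)\ge\mu(I\cup j\setminus i)+\nu(J\cup i\setminus j)$. $\overline{\operatorname{trop}}(\mu)$: for $\mu$ of rank $r$ and $I\in\binom{[n]}{r+1}$ let $C_\mu(I)_i=\mu(I\setminus i)$ for $i\in I$, $\infty$ otherwise; valuated circuits are the images in $\mathbb P(\mathbb T^n)$ of those not identically $\infty$; $\overline{\operatorname{trop}}(\mu)$ is the set of $x\in\mathbb P(\mathbb T^n)$ such that for every valuated circuit $C$, $\min_i(C_i+x_i)$ is attained at least twice or is $\infty$.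 $\mu_S$: with $M$ the underlying matroid (bases $B$ with $\mu(B)\ne\infty$), $k=\operatorname{rk}(M\setminus S)$, choose $I\subseteq S$, $|I|=r-k$, with $([n]\setminus S)\cup I$ of rank $r$; $\mu_S(B)=\mu(B\cup I)$ for $B\in\binom{[n]}k$ disjoint from $S$, $\infty$ otherwise. $\mathrm{pr}^{\operatorname{trop}}_S:\mathbb T^n\to\mathbb T^n$ replaces coordinates in $S$ by $\infty$; for $X\subseteq\mathbb P(\mathbb T^n)$, $\mathrm{pr}^{\operatorname{trop}}_S(X)$ is the image in $\mathbb P(\mathbb T^n)$ of $\mathrm{pr}^{\operatorname{trop}}_S(\varphi^{-1}(X))\setminus\{(\infty,\dots,\infty)\}$, $\varphi$ the quotient map. *)

(* Defs.v *)
From HB Require Import structures.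
From mathcomp Require Import all_boot all_order all_algebra.
From mathcomp Require Import boolp classical_sets reals constructive_ereal.
From mathcomp.boot Require Import fintype finset.

Set Implicit Arguments.
Unset Strict Implicit.
Unset Printing Implicit Defensive.

Import Order.TTheory GRing.Theory Num.Theory.

Local Open Scope classical_set_scope.
Local Open Scope ereal_scope.
Local Open Scope quotient_scope.

(* R \cup {+oo}, as a subtype of the extended reals: sums, minima and
   comparisons are those of \bar R through the coercion [trop_val]. *)
Record trop (R : realType) := Trop {
  trop_val :> \bar R;
  trop_valP : trop_val != -oo }.

HB.instance Definition _ (R : realType) := [isSub for @trop_val R].
HB.instance Definition _ (R : realType) := [Choice of trop R by <:].

Definition tinf (R : realType) : trop R := @Trop R +oo isT.

Section TropicalProjectiveSpace.
Variables (R : realType) (n : nat).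

Definition tvec := {ffun 'I_n -> trop R}.

Definition tvec_inf : tvec := [ffun => tinf R].

(* T^n \ {(oo, ..., oo)} *)
Definition tpoint := {x : tvec | x != tvec_inf}.

(* Same orbit under the translation action of R 1. *)
Definition tproj_eq (x y : tpoint) : bool :=
  `[< exists c : R, forall i, trop_val (val y i) = val x i + c%:E >].

Lemma tproj_eq_refl : reflexive tproj_eq.
Proof. by move=> x; apply/asboolP; exists 0%R => i; rewrite adde0. Qed.

Lemma tproj_eq_sym : symmetric tproj_eq.
Proof.
suff H x y : tproj_eq x y -> tproj_eq y x by move=> x y; apply/idP/idP; exact: H.
move=> /asboolP[c xy]; apply/asboolP; exists (- c)%R => i.
by rewrite xy -addeA -EFinD subrr adde0.
Qed.

Lemma tproj_eq_trans : transitive tproj_eq.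
Proof.
move=> y x z /asboolP[c xy] /asboolP[d yz]; apply/asboolP; exists (c + d)%R => i.
by rewrite yz xy -addeA -EFinD.
Qed.

Canonical tproj_equiv := EquivRel tproj_eq tproj_eq_refl tproj_eq_sym tproj_eq_trans.

Definition tproj := {eq_quot tproj_equiv}.

Definition tclass (x : tpoint) : tproj := \pi_tproj x.

Definition tvec_del (S : {set 'I_n}) (x : tvec) : tvec :=
  [ffun i => if i \in S then tinf R else x i].

(* pr_S^trop on subsets of P(T^n); taking the preimage under [val] discards the
   vector (oo, ..., oo) before passing to classes. *)
Definition tproj_del (S : {set 'I_n}) (X : set tproj) : set tproj :=
  tclass @` (val @^-1` (tvec_del S @` (val @` (tclass @^-1` X)))).

Definition min_twice_or_inf (c x : tvec) : Prop :=
  let m := \big[mine/+oo]_(i < n) (c i + x i) in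
  m = +oo \/ exists i j, [/\ i != j, c i + x i = m & c j + x j = m].

End TropicalProjectiveSpace.

(* A function on the r-subsets of [n] is represented by its extension by +oo to
   all subsets.  Valuated matroids are given by representatives modulo additive
   constants. *)
Record valmat (R : realType) (n r : nat) := ValMat {
  vm_fun :> {set 'I_n} -> trop R;
  vm_card : forall B, vm_fun B != tinf R -> #|B| = r;
  vm_neq_inf : exists B, vm_fun B != tinf R;
  vm_exchange : forall I J : {set 'I_n}, #|I| = r -> #|J| = r ->
    forall i, i \in I :\: J ->
    exists2 j, j \in J :\: I &
      vm_fun I + vm_fun J >= vm_fun (j |: (I :\ i)) + vm_fun (i |: (J :\ j)) }.

Definition vquotient (R : realType) (n a b : nat)
    (mu : valmat R n a) (nu : valmat R n b) : Prop :=
  (a <= b)%N /\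
  forall I J : {set 'I_n}, #|I| = a -> #|J| = b ->
    forall i, i \in I :\: J ->
    exists2 j, j \in J :\: I &
      mu I + nu J >= mu ((j |: I) :\ i) + nu ((i |: J) :\ j).

Section ValuatedMatroid.
Variables (R : realType) (n r : nat) (mu : valmat R n r).

(* C_mu(I), meaningful for #|I| = r + 1. *)
Definition vcircuit_vec (I : {set 'I_n}) : tvec R n :=
  [ffun i => if i \in I then mu (I :\ i) else tinf R].

Definition vcircuits : set (tproj R n) :=
  [set p | exists (I : {set 'I_n}) (c : tpoint R n),
     [/\ #|I| = r.+1, val c = vcircuit_vec I & p = tclass c] ].

(* The min condition does not depend on the representatives c and x. *)
Definition tropbar : set (tproj R n) :=
  [set p | forall c x : tpoint R n, vcircuits (tclass c) -> tclass x = p ->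
     min_twice_or_inf (val c) (val x)].

Definition vbasis (B : {set 'I_n}) : bool := mu B != tinf R.

Definition vrank (A : {set 'I_n}) : nat := \max_(B | vbasis B) #|B :&: A|.

Definition del_choice (S I : {set 'I_n}) : Prop :=
  [/\ I \subset S, #|I| = (r - vrank (~: S))%N & vrank (~: S :|: I) = r].

Lemma vrank_attained (A : {set 'I_n}) :
  exists2 B, vbasis B & vrank A = #|B :&: A|.
Proof.
have [B0 B0b] := vm_neq_inf mu.
have H : (0 < #|[pred B | vbasis B]|)%N by apply/card_gt0P; exists B0.
by have [B Bb E] := eq_bigmax_cond (fun B => #|B :&: A|) H; exists B.
Qed.

Lemma vbasis_card B : vbasis B -> #|B| = r.
Proof. exact: vm_card. Qed.

Lemma vrank_ge (A B : {set 'I_n}) : vbasis B -> (#|B :&: A| <= vrank A)%N.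
Proof.
move=> Bb.
exact: (@leq_bigmax_cond _ (fun B => vbasis B) (fun B => #|B :&: A|)).
Qed.

Lemma vrank_le (A : {set 'I_n}) : (vrank A <= r)%N.
Proof.
have [B Bb ->] := vrank_attained A.
by rewrite -(vbasis_card Bb) subset_leq_card ?subsetIl.
Qed.

Lemma del_choice_exists S : exists I, del_choice S I.
Proof.
have [B Bb E] := vrank_attained (~: S); exists (B :&: S); split.
- exact: subsetIr.
- by rewrite E -(vbasis_card Bb) -setDE -(cardsID S B) addnK.
- apply/eqP; rewrite eqn_leq vrank_le /= -{1}(vbasis_card Bb).
  apply: leq_trans (vrank_ge _ Bb); apply: subset_leq_card; apply/subsetP => x xB.
  by rewrite !inE xB /= orNb.
Qed.

Section Deletion.
Variables (S I : {set 'I_n}).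
Hypothesis hI : del_choice S I.

Definition del_fun (B : {set 'I_n}) : trop R :=
  if (#|B| == vrank (~: S)) && [disjoint B & S] then mu (B :|: I) else tinf R.

Lemma del_fun_card B : del_fun B != tinf R -> #|B| = vrank (~: S).
Proof. by rewrite /del_fun; case: (#|B| =P _) => //= _; rewrite eqxx. Qed.

Lemma del_fun_neq_inf : exists B, del_fun B != tinf R.
Proof.
case: hI => sIS cI rI.
have [B Bb E] := vrank_attained (~: S :|: I).
have sB : B \subset ~: S :|: I.
  apply/setIidPl/eqP; rewrite eqEcard subsetIl /= -E rI.
  by rewrite (vbasis_card Bb).
have sBI : B :&: S \subset I.
  apply/subsetP => x; rewrite !inE => /andP[xB xS].
  by have /subsetP/(_ x xB) := sB; rewrite !inE xS.
have kr := vrank_le (~: S).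
have cB : (#|B :&: S| + #|B :\: S| = r)%N by rewrite cardsID (vbasis_card Bb).
have le1 : (#|B :&: S| <= r - vrank (~: S))%N by rewrite -cI subset_leq_card.
have le2 : (#|B :\: S| <= vrank (~: S))%N by rewrite setDE vrank_ge.
have e2 : #|B :\: S| = vrank (~: S).
  apply/eqP; rewrite eqn_leq le2 /= -(leq_add2l #|B :&: S|) cB.
  by rewrite -(subnK kr) leq_add2r.
have e1 : B :&: S = I.
  apply/eqP; rewrite eqEcard sBI cI /= -(leq_add2r #|B :\: S|) cB e2.
  by rewrite subnK.
exists (B :\: S); rewrite /del_fun e2 eqxx /=.
have -> : [disjoint B :\: S & S]%B.
  by rewrite -setI_eq0 setDE -setIA [~: S :&: S]setIC setICr setI0 eqxx.
by rewrite -{1}e1 setUC setID.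
Qed.

Lemma del_fun_exchange (J K : {set 'I_n}) :
    #|J| = vrank (~: S) -> #|K| = vrank (~: S) ->
  forall i, i \in J :\: K ->
  exists2 j, j \in K :\: J &
    del_fun J + del_fun K >= del_fun (j |: (J :\ i)) + del_fun (i |: (K :\ j)).
Proof.
case: hI => sIS cI _ cJ cK i iJK.
have [iK iJ] : i \notin K /\ i \in J by move: iJK; rewrite !inE => /andP.
have [dJ|dJ] := boolP [disjoint J & S]%B; last first.
  have [j jKJ] : exists j, j \in K :\: J.
    apply/set0Pn; rewrite -card_gt0 cardsD cK -cJ setIC -cardsD card_gt0.
    by apply/set0Pn; exists i.
  exists j => //; rewrite {3}/del_fun (negPf dJ) andbF /=.
  by rewrite addye ?leey //; exact: trop_valP.
have [dK|dK] := boolP [disjoint K & S]%B; last first.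
  have [j jKJ] : exists j, j \in K :\: J.
    apply/set0Pn; rewrite -card_gt0 cardsD cK -cJ setIC -cardsD card_gt0.
    by apply/set0Pn; exists i.
  exists j => //; rewrite {4}/del_fun (negPf dK) andbF /=.
  by rewrite addey ?leey //; exact: trop_valP.
have nS (L : {set 'I_n}) x : [disjoint L & S]%B -> x \in L -> x \notin S.
  by move=> /pred0P/(_ x) /=; case: (x \in L) => //= ->.
have nI x : x \notin S -> x \notin I by apply: contra; apply/subsetP.
have dI (L : {set 'I_n}) : [disjoint L & S]%B -> [disjoint L & I]%B.
  by move=> d; apply: disjointWr d.
have cU (L : {set 'I_n}) : #|L| = vrank (~: S) -> [disjoint L & S]%B -> #|L :|: I| = r.
  move=> cL /dI d; rewrite cardsU disjoint_setI0 // cards0 subn0 cL cI.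
  by rewrite subnKC ?vrank_le.
have iI : i \notin I by apply: nI; exact: nS iJ.
have [|j jKJ le] := @vm_exchange _ _ _ mu _ _ (cU _ cJ dJ) (cU _ cK dK) i.
  by rewrite !inE negb_or iK iI iJ.
move: jKJ; rewrite !inE negb_or => /andP[/andP[jJ jI]].
rewrite (negPf jI) orbF => jK.
have jS : j \notin S := nS _ _ dK jK.
have iS : i \notin S := nS _ _ dJ iJ.
exists j; first by rewrite !inE jJ.
have dX (L : {set 'I_n}) x y : [disjoint L & S]%B -> x \notin S -> [disjoint x |: (L :\ y) & S]%B.
  rewrite !disjoints_subset subUset sub1set inE => LS -> /=.
  by apply: subset_trans LS; exact: subsetDl.
have cX (L : {set 'I_n}) x y : x \notin L -> y \in L -> #|x |: (L :\ y)| = #|L|.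
  by move=> xL yL; rewrite cardsU1 (cardsD1 y L) yL !inE (negPf xL) andbF.
have eX (L : {set 'I_n}) x y : y \notin I -> (x |: (L :\ y)) :|: I = x |: ((L :|: I) :\ y).
  move=> yI; rewrite setDUl -setUA; congr (_ |: (_ :|: _)); apply/setP => z.
  by rewrite !inE; case: eqP => // ->; rewrite (negPf yI).
by rewrite /del_fun !cX // cJ cK eqxx !dX // dJ dK /= !eX.
Qed.

(* mu_S, for the chosen I; its rank is that of M \ S. *)
Definition deletion : valmat R n (vrank (~: S)) :=
  ValMat del_fun_card del_fun_neq_inf del_fun_exchange.

End Deletion.

End ValuatedMatroid.

Arguments deletion {R n r} mu {S I} hI.

(* Main.v *)
(* For |K| = k - 1 and |J| = b + 1, where k is the rank of mu_S, the exchange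
   inequalities of the quotient say exactly that the cocircuit
   j |-> mu_S(K + j) is tropically orthogonal to the circuit j |-> nu(J - j).
   So mu_S is a quotient of nu as soon as the cocircuits of mu_S, which are
   projections of cocircuits of mu, lie in trop(nu); this also forces k <= b.
   Conversely the projection of any x in trop(mu) is a tropical combination of
   cocircuits of mu_S, because every finite coordinate of it is touched from
   above by such a cocircuit, and orthogonality to a circuit passes to
   tropical combinations. *)
Require Import Defs.
From mathcomp Require Import all_boot all_order all_algebra.
From mathcomp Require Import boolp classical_sets reals constructive_ereal.
From mathcomp.boot Require Import finset.

Set Implicit Arguments.
Unset Strict Implicit.
Unset Printing Implicit Defensive.

Import Order.TTheory GRing.Theory Num.Theory.

Local Open Scope ereal_scope.

(** * The tropical minimum condition, coordinate by coordinate *)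

Section TropicalVectors.
Variables (R : realType) (n : nat).
Implicit Types (s t : trop R) (c x : tvec R n).

Lemma trop_eqy t : (t == tinf R) = (trop_val t == +oo).
Proof. by rewrite -val_eqE. Qed.

Lemma trop_fineK t : t != tinf R -> trop_val t = (fine t)%:E.
Proof. by rewrite trop_eqy; case: t => [[r| |]]. Qed.

Lemma trop_add_eqy s t :
  (trop_val s + trop_val t == +oo) = (s == tinf R) || (t == tinf R).
Proof. by rewrite !trop_eqy; case: s t => [[r| |] ?] [[q| |] ?]. Qed.

(** Only an index attaining the minimum matters: a rival that is no larger there attains it too. *)
Lemma min_twice_or_infP c x :
  min_twice_or_inf c x <->
  (forall i, c i + x i != +oo -> exists2 j, j != i & c j + x j <= c i + x i).
Proof.
rewrite /min_twice_or_inf.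
set m := \big[_/_]_(i < n) _.
have le_m i : m <= c i + x i by rewrite /m (bigD1 i) //= ge_min lexx.
split=> [[m_oo i|[i1 [i2 [ne12 E1 E2]]] i _]|H].
- by rewrite -leye_eq -m_oo le_m.
- have [Ei|ni] := eqVneq i1 i; last by exists i1; rewrite ?E1.
  by exists i2; rewrite ?E2 // -Ei eq_sym.
- have [->|m_fin] := eqVneq m +oo; [by left | right].
  have [i Ei] : exists i, c i + x i = m.
    apply: contrapT => nE; move/eqP: m_fin; apply.
    have lt_m i : m < c i + x i.
      by rewrite lt_neqAle le_m andbT; apply/eqP => E; apply: nE; exists i.
    (* The default [+oo] of the iterated minimum is why it is either infinite or attained. *)
    have : m = +oo \/ exists i, c i + x i = m.
      rewrite /m; elim/big_ind: _ => [|u v [->|[i Eu]] [->|[j Ev]]|i _]; first by left.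
      + by left; rewrite minxx.
      + by right; exists j; rewrite minye.
      + by right; exists i; rewrite miney.
      + by right; rewrite minEle; case: ifP; [exists i | exists j].
      + by right; exists i.
    by case=> // /nE.
  have [|j ji le_ji] := H i; first by rewrite Ei.
  exists i, j; split=> //; first by rewrite eq_sym.
  by apply/eqP; rewrite eq_le le_m -Ei le_ji.
Qed.

Lemma tclassP (x y : tpoint R n) : tclass x = tclass y ->
  exists d : R, forall i, trop_val (val y i) = val x i + d%:E.
Proof. by move=> /eqquotP /asboolP. Qed.

End TropicalVectors.

(** * Tropical linear spaces and their cocircuits *)

Section TropicalLinearSpace.
Variables (R : realType) (n r : nat) (mu : valmat R n r).

(** Membership in trop(mu) for representatives. Identically infinite circuit vectors impose nothing,
    so all sets of size [r.+1] are allowed. *)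
Definition trop_orthogonal (x : tvec R n) : Prop :=
  forall I : {set 'I_n}, #|I| = r.+1 -> forall i, i \in I ->
    mu (I :\ i) + x i != +oo ->
  exists j, [/\ j \in I, j != i & mu (I :\ j) + x j <= mu (I :\ i) + x i].

Lemma tropbarP (x : tpoint R n) : tropbar mu (tclass x) <-> trop_orthogonal (val x).
Proof.
split=> [H I cI i iI fin_i|H c y [I [c0 [cI Ec0 Ec]]] Ey].
  have c_neq : vcircuit_vec mu I != tvec_inf R n.
    apply: contraNneq fin_i => /ffunP/(_ i); rewrite !ffunE iI => ->.
    by rewrite addye //; exact: trop_valP.
  pose c : tpoint R n := exist (fun z => z != tvec_inf R n) _ c_neq.
  have cc : vcircuits mu (tclass c) by exists I, c.
  have /min_twice_or_infP/(_ i) := H c x cc erefl.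
  rewrite /= ffunE iI => /(_ fin_i)[j ji]; rewrite ffunE.
  case: ifP => [jI le_ji|jI]; first by exists j.
  by rewrite addye ?leye_eq ?(negPf fin_i) //; exact: trop_valP.
(* Changing both representatives shifts every sum by the same [d + e], which preserves
   comparisons. *)
have [d Ed] := tclassP (esym Ec); have [e Ee] := tclassP (esym Ey).
have E i : val c i + val y i = vcircuit_vec mu I i + val x i + (d + e)%:E.
  by rewrite Ed Ee Ec0 EFinD addeACA.
apply/min_twice_or_infP => i; rewrite E ffunE.
have [iI fin_i|_] := boolP (i \in I); last by rewrite !addye ?eqxx //; exact: trop_valP.
have [|j [jI ji le_ji]] := H I cI i iI.
  by apply: contraNneq fin_i => ->; rewrite addye.
by exists j => //; rewrite !E !ffunE jI leeD2r.
Qed.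

(** This is basis exchange between [i |: K] and [I :\ i] at [i]. If [#|K|.+1 < r], every entry is
    infinite and nothing is asked. *)
Lemma cocircuit_orthogonal (K : {set 'I_n}) : (#|K| < r)%N ->
  trop_orthogonal [ffun j => mu (j |: K)].
Proof.
move=> ltK I cI i iI; rewrite ffunE trop_add_eqy negb_or => /andP[_ finK].
have iK : i \notin K.
  by apply: contraTN ltK => iK; rewrite -(vm_card finK) setUC (setUidPl _) ?ltnn ?sub1set.
have cIi : #|I :\ i| = r by apply/eqP; rewrite -eqSS -cI (cardsD1 i I) iI.
have iD : i \in (i |: K) :\: (I :\ i) by rewrite !inE !eqxx.
have [j] := vm_exchange mu (vm_card finK) cIi iD.
rewrite !inE negb_or setU1K // => /andP[/andP[ji jK] /andP[_ jI]].
have -> : i |: (I :\ i :\ j) = I :\ j.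
  by apply/setP => z; rewrite !inE; case: (eqVneq z i) => // ->; rewrite iI eq_sym ji.
rewrite addeC [X in _ <= X]addeC => le_ji.
by exists j; rewrite !ffunE.
Qed.

End TropicalLinearSpace.

(** * Cocircuits of the deletion *)

Section Deletion.
Variables (R : realType) (n a : nat) (mu : valmat R n a) (S I : {set 'I_n}).
Hypothesis hI : del_choice mu S I.
Local Notation k := (vrank mu (~: S)).
Local Notation delta := (deletion mu hI).

Lemma deletion_fin (B : {set 'I_n}) : delta B != tinf R ->
  [/\ #|B| = k, [disjoint B & S]%B & delta B = mu (B :|: I)].
Proof. by rewrite /= /del_fun; case: ifP => [/andP[/eqP]|]; rewrite ?eqxx. Qed.

Lemma deletionE (B : {set 'I_n}) : #|B| = k -> [disjoint B & S]%B ->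
  delta B = mu (B :|: I).
Proof. by move=> cB dB; rewrite /= /del_fun cB eqxx dB. Qed.

Lemma deletion_notin (B : {set 'I_n}) j : delta B != tinf R -> j \in S -> j \notin B.
Proof. by move=> /deletion_fin[_ dB _] jS; apply: contraTN jS => /(disjointFr dB)->. Qed.

Lemma deletion_card_add (B : {set 'I_n}) : #|B| = k -> [disjoint B & S]%B ->
  #|B :|: I| = a.
Proof.
case: hI => sIS cI _ cB dB.
by rewrite cardsU disjoint_setI0 ?cards0 ?subn0 ?cB ?cI ?subnKC ?vrank_le ?(disjointWr sIS).
Qed.

(** For [j] in [K] both sides are infinite by cardinality: [K] is one element short of [k], and
    [K :|: I] one short of [a]. *)
Lemma deletion_cocircuit (K : {set 'I_n}) :
    #|K|.+1 = k -> [disjoint K & S]%B ->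
  tvec_del S [ffun j => mu (j |: (K :|: I))] = [ffun j => delta (j |: K)].
Proof.
move=> cK dK; apply/ffunP => j; rewrite !ffunE.
have [jS|jS] := boolP (j \in S).
  apply/eqP; rewrite eq_sym; apply: contraT => /deletion_notin/(_ jS).
  by rewrite setU11.
have dj : [disjoint j |: K & S]%B.
  by rewrite -setI_eq0 setIUl (disjoint_setI0 dK) setU0 setI_eq0 disjoints1.
have [jK|jK] := boolP (j \in K); last first.
  by rewrite deletionE ?setUA // cardsU1 jK.
have -> : delta (j |: K) = tinf R.
  apply/eqP; apply: contraT => /deletion_fin[/eqP + _ _].
  by rewrite -cK setUC (setUidPl _) ?sub1set // ltn_eqF.
apply/eqP; apply: contraT => /vm_card /eqP.
have [sIS cI _] := hI.
rewrite setUC (setUidPl _) ?sub1set ?inE ?jK //.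
rewrite cardsU disjoint_setI0 ?(disjointWr sIS) // cards0 subn0 cI ltn_eqF //.
by rewrite addnC -ltn_subRL subKn ?vrank_le // -cK.
Qed.

(* Some cocircuit of delta touches the projection of x from above at j0. The
   coordinates of x equal to +oo act as infinite weights, so j0 |: K is taken
   among the bases optimal for the pair (number of infinite coordinates, total
   weight), compared lexicographically. *)
Lemma orthogonal_cocircuit (x : tvec R n) j0 :
    trop_orthogonal mu x -> j0 \notin S -> x j0 != tinf R ->
  exists (K : {set 'I_n}) (c : R), [/\ j0 \notin K, delta (j0 |: K) + c%:E = x j0 &
    forall j, tvec_del S x j <= delta (j |: K) + c%:E].
Proof.
move=> ox j0S xj0.
pose F := [set i | x i == tinf R].
(* The weight of [delta] tilted by [-x], over finite coordinates only so that it stays real; the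
   infinite ones are counted by [#|B :&: F|]. *)
pose w (B : {set 'I_n}) : R := (fine (delta B) - \sum_(i in B :\: F) fine (x i))%R.
have [B0 B0fin] := vm_neq_inf delta.
have [B1 B1fin maxB1] := @arg_maxnP _ B0 (fun B => delta B != tinf R)
   (fun B => #|B :&: F|) B0fin.
pose P (B : {set 'I_n}) := (delta B != tinf R) && (#|B :&: F| == #|B1 :&: F|).
have PB1 : P B1 by rewrite /P B1fin eqxx.
have wD1 (B : {set 'I_n}) i : i \in B -> i \notin F ->
    w B = (fine (delta B) - fine (x i) - \sum_(l in (B :\ i) :\: F) fine (x l))%R.
  move=> iB iF; rewrite /w (big_setD1 i) ?in_setD ?iF // opprD addrA.
  by have -> : B :\: F :\ i = B :\ i :\: F by rewrite !setDDl setUC.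
have capF (K : {set 'I_n}) i :
    (i |: K) :&: F = if i \in F then i |: (K :&: F) else K :&: F.
  rewrite setIUl; case: ifP => iF.
    by congr (_ :|: _); apply/setIidPl; rewrite sub1set.
  rewrite (_ : [set i] :&: F = set0) ?set0U //.
  by apply/eqP; rewrite setI_eq0 disjoints1 iF.
have j0F : j0 \notin F by rewrite inE.
(* An optimal basis can be exchanged for one containing [j0]: orthogonality of [x] to the circuit of
   [mu] on [j0 |: (B :|: I)] supplies the element that leaves. *)
have [B [j0B /andP[Bfin /eqP BF] minB]] : exists B : {set 'I_n},
    [/\ j0 \in B, P B & forall B', P B' -> (w B <= w B')%R].
  case: (@Order.TotalTheory.arg_minP _ _ _ B1 P w PB1) => B PB minB.
  have [j0B|j0B] := boolP (j0 \in B); first by exists B.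
  have /andP[Bfin /eqP BF] := PB.
  have [cB dB EB] := deletion_fin Bfin.
  have j0I : j0 \notin I by case: hI => /fintype.subsetP sIS _ _; apply: contra j0S => /sIS.
  have j0BI : j0 \notin B :|: I by rewrite inE negb_or j0B.
  have [||i] := ox (j0 |: (B :|: I)) _ j0 (setU11 _ _).
  - by rewrite cardsU1 j0BI deletion_card_add.
  - by rewrite setU1K // trop_add_eqy negb_or -EB Bfin.
  rewrite setU1K // => -[iBI ij0 le_i].
  have {iBI} : i \in B :|: I by move: iBI; rewrite in_setU1 (negPf ij0).
  have : mu ((j0 |: (B :|: I)) :\ i) + x i != +oo.
    apply: contraTneq le_i => ->; rewrite leye_eq trop_add_eqy negb_or -EB.
    by rewrite Bfin.
  rewrite trop_add_eqy negb_or => /andP[mufin xi].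
  (* The leaving element is not in [I]: otherwise a basis of [mu] would contain the [k + 1] elements
     of [j0 |: B], all outside [S]. *)
  rewrite inE => /orP[iB|iI]; last first.
    have := vrank_ge (~: S) mufin.
    rewrite leqNgt => /negP[]; rewrite -cB.
    have <- : #|j0 |: B| = #|B|.+1 by rewrite cardsU1 j0B.
    apply: subset_leq_card; apply/fintype.subsetP => z zB.
    have zS : z \notin S.
      by move: zB; rewrite !inE => /orP[/eqP->//|zB]; rewrite (disjointFr dB).
    have zi : z != i.
      by apply: contraNneq zS => ->; case: hI => /fintype.subsetP/(_ i iI).
    by move: zB; rewrite !inE zS orbA => ->; rewrite !andbT.
  have iF : i \notin F by rewrite inE.
  pose K := B :\ i.
  have iK : i \notin K by rewrite !inE eqxx.
  have j0K : j0 \notin K by rewrite !inE negb_and j0B orbT.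
  have EBK : B = i |: K by rewrite setD1K.
  have iS : i \notin S by rewrite (disjointFr dB).
  have iI : i \notin I by case: hI => /fintype.subsetP sIS _ _; apply: contra iS => /sIS.
  have Emu : delta (j0 |: K) = mu ((j0 |: (B :|: I)) :\ i).
    rewrite deletionE.
    - congr (vm_fun mu _); apply/setP => z; rewrite !inE.
      have [->|] := eqVneq z i; last by rewrite andTb orbA.
      by rewrite (negPf iI) /= !orbF; apply: negbTE.
    - by apply: etrans _ cB; rewrite EBK !cardsU1 iK j0K.
    - rewrite -setI_eq0 setIUl setU_eq0 !setI_eq0 disjoints1 j0S /=.
      by apply: disjointWl dB; exact: subD1set.
  have fin' : delta (j0 |: K) != tinf R by rewrite Emu.
  (* Once the terms over [K] cancel, this is [le_i]. *)
  have w_le : (w (j0 |: K) <= w B)%R.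
    rewrite (wD1 _ j0) ?setU11 // (wD1 _ i) // setU1K //.
    rewrite lerD2r.
    move: le_i; rewrite -EB -Emu.
    rewrite (trop_fineK fin') (trop_fineK Bfin) (trop_fineK xi) (trop_fineK xj0).
    rewrite -!EFinD lee_fin.
    move: (fine (delta (j0 |: K))) (fine (delta B)) (fine (x i)) (fine (x j0)).
    by move=> p q s t /=; rewrite lerBlDr addrAC lerBrDr.
  exists (j0 |: K); split; rewrite ?setU11 // /P.
  - rewrite fin' -BF EBK !capF.
    by rewrite (negPf iF) (negPf j0F) eqxx.
  - by move=> B' /minB; exact: le_trans.
pose K := B :\ j0.
have EB : j0 |: K = B by rewrite setD1K.
have j0K : j0 \notin K by rewrite !inE eqxx.
(* This constant forces equality at [j0]; elsewhere the bound is the optimality of [B] against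
   [j |: K]. *)
exists K, (fine (x j0) - fine (delta B))%R; split=> //.
  by rewrite EB (trop_fineK Bfin) (trop_fineK xj0) -EFinD addrC subrK.
move=> j; have [->|jfin] := eqVneq (delta (j |: K)) (tinf R); first by rewrite leey.
have jS : j \notin S by apply: contraL (setU11 j K) => /(deletion_notin jfin).
have jK : j \notin K.
  have [cj _ _] := deletion_fin jfin; have [cB _ _] := deletion_fin Bfin.
  by move: cj; rewrite -cB -EB !cardsU1 j0K; case: (j \in K) => // /eqP; rewrite ltn_eqF.
rewrite ffunE (negPf jS).
(* Replacing the finite coordinate [j0] by an infinite one would exceed the maximal count. *)
have jF : j \notin F.
  apply/negP => jF.
  have : (#|(j |: K) :&: F| <= #|B1 :&: F|)%N by exact: maxB1.
  rewrite -BF -EB.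
  rewrite !capF jF (negPf j0F).
  by rewrite cardsU1 inE (negPf jK) ltnn.
have xj : x j != tinf R by move: jF; rewrite inE.
have : (w B <= w (j |: K))%R.
  apply: minB; rewrite /P jfin -BF -EB.
  by rewrite !capF (negPf jF) (negPf j0F) eqxx.
rewrite (wD1 _ j0) // (wD1 _ j) ?setU11 // setU1K // -/K lerD2r.
rewrite (trop_fineK jfin) (trop_fineK xj) -EFinD lee_fin.
move: (fine (delta (j |: K))) (fine (delta B)) (fine (x j)) (fine (x j0)).
by move=> p q s t /=; rewrite lerBlDr addrAC lerBrDr addrA lerBrDr (addrC q).
Qed.

End Deletion.

(** * Quotients and inclusion of tropical linear spaces *)

Section Quotient.
Variables (R : realType) (n a b : nat) (mu : valmat R n a) (nu : valmat R n b).
Variables (S I : {set 'I_n}) (hI : del_choice mu S I).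
Local Notation delta := (deletion mu hI).

(** The inclusion is tested on the cocircuit of [delta] given by [A :\ i]; its orthogonality to the
    circuit of [nu] on [i |: J], read at [i], is the exchange inequality. *)
Lemma tproj_del_subset_exchange :
    subset (tproj_del S (tropbar mu)) (tropbar nu) ->
  forall A J : {set 'I_n}, delta A != tinf R -> nu J != tinf R ->
  forall i, i \in A :\: J ->
  exists2 j, j \in J :\: A &
    delta ((j |: A) :\ i) + nu ((i |: J) :\ j) <= delta A + nu J.
Proof.
move=> sub A J Afin Jfin i; rewrite inE => /andP[iJ iA].
pose K := A :\ i.
have EA : i |: K = A by rewrite setD1K.
have [cA dA _] := deletion_fin Afin.
have iK : i \notin K by rewrite !inE eqxx.
have cK : #|K|.+1 = vrank mu (~: S) by rewrite -cA -EA cardsU1 iK.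
have dK : [disjoint K & S]%B by apply: disjointWl dA; exact: subD1set.
pose x : tvec R n := [ffun j => mu (j |: (K :|: I))].
have Ey := deletion_cocircuit hI cK dK; rewrite -/x in Ey.
have y_neq : tvec_del S x != tvec_inf R n.
  by apply: contraNneq Afin; rewrite Ey => /ffunP/(_ i); rewrite !ffunE EA => ->.
have x_neq : x != tvec_inf R n.
  apply: contraNneq y_neq => ->; apply/eqP/ffunP => j.
  by rewrite !ffunE if_same.
pose px : tpoint R n := exist (fun z => z != tvec_inf R n) _ x_neq.
pose py : tpoint R n := exist (fun z => z != tvec_inf R n) _ y_neq.
have ltKI : (#|K :|: I| < a)%N.
  rewrite -(deletion_card_add hI cA dA) -EA -setUA cardsU1 inE negb_or iK.
  have -> : i \notin I; last by rewrite ltnS.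
  case: hI => /fintype.subsetP sIS _ _; apply: contraTN iA => /sIS.
  exact: deletion_notin Afin.
have /tropbarP/(_ (i |: J)) : tropbar nu (tclass py).
  apply: sub; exists py => //; exists x => //; exists px => //.
  by apply/tropbarP; exact: cocircuit_orthogonal.
rewrite cardsU1 iJ (vm_card Jfin) => /(_ erefl i (setU11 _ _)).
rewrite setU1K // [val py]Ey !ffunE EA trop_add_eqy negb_or Jfin Afin.
case=> // j [jJ ji]; rewrite ffunE => le_j.
have {}jJ : j \in J by move: jJ; rewrite in_setU1 (negPf ji).
have EjA : (j |: A) :\ i = j |: K.
  by apply/setP => z; rewrite !inE; case: (eqVneq z i) => // ->; rewrite eq_sym (negPf ji).
(* Otherwise [j] lies in [K], and [delta (j |: K)] is infinite for lack of one element, against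
   [le_j]. *)
have jA : j \notin A.
  apply: contraTN le_j => jA; rewrite -ltNge.
  have -> : delta (j |: K) = tinf R.
    apply/eqP; apply: contraT => /deletion_fin[/eqP + _ _].
    by rewrite -cK setUC (setUidPl _) ?sub1set ?inE ?ji // ltn_eqF.
  rewrite addey; last exact: trop_valP.
  by rewrite ltey trop_add_eqy negb_or Jfin.
by exists j; rewrite ?inE ?jA // EjA addeC [X in _ <= X]addeC.
Qed.

(** Fix a basis [A] of [delta] and a basis [J] of [nu] meeting it in as many elements as possible.
    An element of [A] outside [J] would allow an exchange enlarging the intersection, so [A] lies in
    [J]. *)
Lemma tproj_del_subset_rank :
  subset (tproj_del S (tropbar mu)) (tropbar nu) -> (vrank mu (~: S) <= b)%N.
Proof.
move=> sub.
have [A Afin] := vm_neq_inf delta; have [J0 J0fin] := vm_neq_inf nu.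
have [J Jfin maxJ] := @arg_maxnP _ J0 (fun J => nu J != tinf R)
  (fun J => #|A :&: J|) J0fin.
rewrite -(vm_card Afin) -(vm_card Jfin).
apply/subset_leq_card/fintype.subsetP => i iA; apply: contraT => iJ.
have iAJ : i \in A :\: J by rewrite inE iJ.
have [j jJA le_j] := tproj_del_subset_exchange sub Afin Jfin iAJ.
have : delta ((j |: A) :\ i) + nu ((i |: J) :\ j) != +oo.
  apply: contraTneq le_j => ->; rewrite leye_eq trop_add_eqy negb_or.
  by rewrite Afin.
rewrite trop_add_eqy negb_or => /andP[_ /maxJ].
move: jJA; rewrite inE => /andP[jA jJ].
have ij : i != j by apply: contraNneq jA => <-.
have -> : A :&: ((i |: J) :\ j) = i |: (A :&: J).
  apply/setP => z; rewrite !inE.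
  have [->|zi] := eqVneq z i; first by rewrite iA ij.
  by have [->|] := eqVneq z j; rewrite ?(negPf jA).
by rewrite cardsU1 inE (negPf iJ) andbF /= ltnn.
Qed.

Lemma tproj_del_subset_quotient :
  subset (tproj_del S (tropbar mu)) (tropbar nu) -> vquotient delta nu.
Proof.
move=> sub; have le_kb := tproj_del_subset_rank sub; split=> // A J cA cJ i iAJ.
(* When the bound is infinite any [j] works, and [le_kb] makes [J :\: A] nonempty because [A :\: J]
   is. *)
have [Afin|] := boolP (delta A + nu J == +oo); last first.
  by rewrite trop_add_eqy negb_or => /andP[? ?]; exact: tproj_del_subset_exchange.
have [j jJA] : exists j, j \in J :\: A.
  apply/set0Pn; rewrite -card_gt0.
  have : (0 < #|A :\: J|)%N by rewrite card_gt0; apply/set0Pn; exists i.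
  move/leq_trans; apply; rewrite -(leq_add2l #|A :&: J|) cardsID setIC cardsID.
  by rewrite cA cJ.
by exists j => //; rewrite (eqP Afin) leey.
Qed.

(** Exchange gives the inequality for a cocircuit of [delta] touching the projected [x] from above
    at [i]. It passes to [x], which agrees with the cocircuit at [i] and lies below it at [j]. *)
Lemma quotient_orthogonal (x : tvec R n) : vquotient delta nu ->
  trop_orthogonal mu x -> trop_orthogonal nu (tvec_del S x).
Proof.
move=> [_ quo] ox J cJ i iJ; rewrite trop_add_eqy negb_or => /andP[Jfin].
rewrite ffunE; case: ifPn => [|iS xi]; first by rewrite eqxx.
have [K [c [iK Ec le_c]]] := orthogonal_cocircuit hI ox iS xi.
have Afin : delta (i |: K) != tinf R.
  by apply: contraNneq xi => E; rewrite trop_eqy -Ec E.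
have [|j] := quo _ _ (vm_card Afin) (vm_card Jfin) i; first by rewrite !inE !eqxx.
rewrite !inE negb_or => /andP[/andP[ji jK] /andP[_ jJ]].
have -> : (j |: (i |: K)) :\ i = j |: K.
  apply/setP => z; rewrite !inE; case: (eqVneq z i) => // ->.
  by rewrite eq_sym (negPf ji) (negPf iK).
rewrite setD1K // => le_j.
exists j; split=> //.
rewrite -Ec; apply: (le_trans (leeD2l _ (le_c j))).
by rewrite !addeA leeD2r // addeC [X in _ <= X]addeC.
Qed.

End Quotient.

Theorem theorem3p15 (R : realType) (n a b : nat)
    (mu : valmat R n a) (nu : valmat R n b) (S I : {set 'I_n})
    (hI : del_choice mu S I) :
  vquotient (deletion mu hI) nu <->
  subset (tproj_del S (tropbar mu)) (tropbar nu).
Proof.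
split=> [quo _ [y [_ [x xmu <-] Ey] <-]|]; last exact: tproj_del_subset_quotient.
by apply/tropbarP; rewrite -Ey; apply: (quotient_orthogonal quo); apply/tropbarP.
Qed.
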